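(* Let $m\ge 2$ be an integer, let $I,J\subset\mathbb{R}$ be open intervals, and let $g:I\to\mathbb{R}$, $h:J\to\mathbb{R}$ be smooth functions with $g'(u)\ne 0$ for all $u\in I$ and $h'(v)\neq 0$ for all $v\in J$. Let $M$ be the translation surface in $(\mathbb{R}^3,\|\cdot\|_{2m})$ parametrized by $X(u,v)=(u,v,g(u)+h(v))$, $(u,v)\in I\times J$. Then $M$ is minimal if and only if either $M$ is (part of) a plane, or there is a constant $a\neq 0$ such that, up to a translation of $\mathbb{R}^3$, $M$ is given by $$X(u,v)=\left(u,\ v,\ \int\{(F_m)^{-1}(au)\}^{2m-1}\,du+\int\{(F_m)^{-1}(-av)\}^{2m-1}\,dv\right),$$ where $F_m(s)=(2m-1)\int_0^s\frac{d\sigma}{1+\sigma^{2m}}$ and the two integrals in the third coordinate denote antiderivatives. Moreover, the surface given by this formula is, up to a translation of $\mathbb{R}^3$, reparametrized via $s=(F_m)^{-1}(au)$, $t=(F_m)^{-1}(-av)$ as $$X(s,t)=\frac1a\left(F_m(s),\ -F_m(t),\ \frac{2m-1}{2m}\left\{\log(1+s^{2m})-\log(1+t^{2m})\right\}\right).$$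
   Context: $\|x\|_{2m}=(x_1^{2m}+x_2^{2m}+x_3^{2m})^{1/(2m)}$ on $\mathbb{R}^3$, $\Phi(x)=x_1^{2m}+x_2^{2m}+x_3^{2m}$, and $S=\{x\in\mathbb{R}^3:\Phi(x)=1\}$ is the unit sphere. A nonzero vector $v$ is Birkhoff orthogonal to a plane $\Pi$ if the tangent plane of $S$ at $v/\|v\|_{2m}$ is parallel to $\Pi$. For an immersed surface $M$, the (local) Birkhoff-Gauss map $\eta:M\to S$ is a smooth choice of $\eta(p)\in S$ Birkhoff orthogonal to $T_pM$; equivalently, for a parametrization $X(u,v)$, $(\operatorname{grad}\Phi)_{\eta}=\varphi\,X_u\times X_v$ for a positive function $\varphi$ (with $\times$ the standard cross product). Since the tangent plane of $S$ at $\eta(p)$ is parallel to $T_pM$, $d\eta_p$ is regarded as an endomorphism of $T_pM$. The mean curvature is $H=\frac12\operatorname{trace}(d\eta_p)$, and $M$ is called minimal if $H=0$ identically. The function $F_m$ is strictly increasing on $\mathbb{R}$, with bounded range; $(F_m)^{-1}$ is its inverse on that range, and in the formulas the parameters $u,v$ are restricted to intervals on which $au$ and $-av$ lie in this range and (because $g',h'\ne0$) are nonzero. *)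

(* Defs.v *)
From Stdlib Require Import Reals ClassicalEpsilon.
From Coquelicot Require Import Coquelicot.
Open Scope R_scope.

Notation R3 := (R * R * R)%type.

Definition x1 (x : R3) : R := fst (fst x).
Definition x2 (x : R3) : R := snd (fst x).
Definition x3 (x : R3) : R := snd x.

Definition dot (x y : R3) : R := x1 x * x1 y + x2 x * x2 y + x3 x * x3 y.

Definition cross (x y : R3) : R3 :=
  (x2 x * x3 y - x3 x * x2 y,
   x3 x * x1 y - x1 x * x3 y,
   x1 x * x2 y - x2 x * x1 y).

Definition grad (f : R3 -> R) (x : R3) : R3 :=
  (Derive (fun t => f (t, x2 x, x3 x)) (x1 x),
   Derive (fun t => f (x1 x, t, x3 x)) (x2 x),
   Derive (fun t => f (x1 x, x2 x, t)) (x3 x)).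

Definition nonempty_open_interval (I : R -> Prop) : Prop :=
  (exists x, I x) /\ open I /\
  (forall x y z, I x -> I z -> x <= y <= z -> I y).

(* C^infinity on an open set; [g] is total but its values off [I] are
   irrelevant since [I] is open. *)
Definition smooth_on (I : R -> Prop) (g : R -> R) : Prop :=
  forall (n : nat) (x : R), I x -> ex_derive_n g n x.

Definition rect (I J : R -> Prop) (u v : R) : Prop := I u /\ J v.

Fixpoint Ck2_on (k : nat) (D : R -> R -> Prop) (f : R -> R -> R) : Prop :=
  (forall u v, D u v -> continuity_2d_pt f u v) /\
  match k with
  | O => True
  | S k' =>
      (forall u v, D u v ->
         ex_derive (fun t => f t v) u /\ ex_derive (fun t => f u t) v) /\
      Ck2_on k' D (fun u v => Derive (fun t => f t v) u) /\
      Ck2_on k' D (fun u v => Derive (fun t => f u t) v)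
  end.

Definition smooth2_on (D : R -> R -> Prop) (Y : R -> R -> R3) : Prop :=
  forall k : nat,
    Ck2_on k D (fun u v => x1 (Y u v)) /\
    Ck2_on k D (fun u v => x2 (Y u v)) /\
    Ck2_on k D (fun u v => x3 (Y u v)).

Definition du (Y : R -> R -> R3) (u v : R) : R3 :=
  (Derive (fun t => x1 (Y t v)) u,
   Derive (fun t => x2 (Y t v)) u,
   Derive (fun t => x3 (Y t v)) u).

Definition dv (Y : R -> R -> R3) (u v : R) : R3 :=
  (Derive (fun t => x1 (Y u t)) v,
   Derive (fun t => x2 (Y u t)) v,
   Derive (fun t => x3 (Y u t)) v).

Definition Phi (m : nat) (x : R3) : R :=
  x1 x ^ (2 * m) + x2 x ^ (2 * m) + x3 x ^ (2 * m).

(* The case distinction is needed because [Rpower 0 y = 1]. *)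
Definition norm2m (m : nat) (x : R3) : R :=
  if Req_EM_T (Phi m x) 0 then 0 else Rpower (Phi m x) (/ (2 * INR m)).

Definition unit_sphere (m : nat) (x : R3) : Prop := Phi m x = 1.

(* Planes enter parallelism and tangency only through their directions, i.e.
   as 2-dimensional linear subspaces. *)
Definition sphere_tangent (m : nat) (x w : R3) : Prop :=
  dot (grad (Phi m) x) w = 0.

Definition tangent_plane (X : R -> R -> R3) (u v : R) (w : R3) : Prop :=
  exists a b : R, w = plus (scal a (du X u v)) (scal b (dv X u v)).

Definition birkhoff_orthogonal (m : nat) (n : R3) (P : R3 -> Prop) : Prop :=
  n <> zero /\
  forall w, sphere_tangent m (scal (/ norm2m m n) n) w <-> P w.

(* The Birkhoff-Gauss map of the parametrized surface [X] on [D]. Birkhoff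
   orthogonality leaves both [eta] and [- eta]; the last clause selects the one
   on the side of X_u x X_v. *)
Definition birkhoff_gauss_map (m : nat) (D : R -> R -> Prop)
    (X eta : R -> R -> R3) : Prop :=
  smooth2_on D eta /\
  forall u v, D u v ->
    unit_sphere m (eta u v) /\
    birkhoff_orthogonal m (eta u v) (tangent_plane X u v) /\
    exists phi : R, 0 < phi /\
      grad (Phi m) (eta u v) = scal phi (cross (du X u v) (dv X u v)).

(* d eta sends X_u to eta_u and X_v to eta_v; its trace is computed from its
   matrix in the basis (X_u, X_v) of the tangent plane. *)
Definition is_mean_curvature (X eta : R -> R -> R3) (u v H : R) : Prop :=
  exists a b c d : R,
    du eta u v = plus (scal a (du X u v)) (scal b (dv X u v)) /\
    dv eta u v = plus (scal c (du X u v)) (scal d (dv X u v)) /\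
    H = / 2 * (a + d).

Definition minimal (m : nat) (D : R -> R -> Prop) (X : R -> R -> R3) : Prop :=
  exists eta, birkhoff_gauss_map m D X eta /\
    forall u v, D u v -> is_mean_curvature X eta u v 0.

Definition translation_surface (g h : R -> R) (u v : R) : R3 :=
  (u, v, g u + h v).

Definition in_plane (D : R -> R -> Prop) (X : R -> R -> R3) : Prop :=
  exists (n : R3) (d : R), n <> zero /\ forall u v, D u v -> dot n (X u v) = d.

Definition surface (D : R -> R -> Prop) (X : R -> R -> R3) (x : R3) : Prop :=
  exists u v, D u v /\ x = X u v.

Definition equal_up_to_translation (M N : R3 -> Prop) : Prop :=
  exists T : R3, forall x, M x <-> N (plus T x).

Definition F (m : nat) (s : R) : R :=
  (2 * INR m - 1) * RInt (fun sigma => / (1 + sigma ^ (2 * m))) 0 s.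

Definition F_range (m : nat) (y : R) : Prop := exists s, F m s = y.

(* [F m] is injective, so on [F_range m] this is its inverse; elsewhere the
   value is arbitrary. *)
Definition Finv (m : nat) (y : R) : R :=
  epsilon (inhabits 0) (fun s => F m s = y).

(* Parameter intervals [I], [J] and antiderivatives [G], [K] for which the
   explicit formula makes sense: its surface is [translation_surface G K]. *)
Definition explicit_data (m : nat) (a : R) (I J : R -> Prop) (G K : R -> R)
    : Prop :=
  nonempty_open_interval I /\ nonempty_open_interval J /\
  (forall u, I u -> F_range m (a * u) /\ a * u <> 0) /\
  (forall v, J v -> F_range m (- a * v) /\ - a * v <> 0) /\
  (forall u, I u -> is_derive G u (Finv m (a * u) ^ (2 * m - 1))) /\
  (forall v, J v -> is_derive K v (Finv m (- a * v) ^ (2 * m - 1))).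

Definition explicit_st (m : nat) (a : R) (s t : R) : R3 :=
  scal (/ a)
    (F m s, - F m t,
     (2 * INR m - 1) / (2 * INR m) *
       (ln (1 + s ^ (2 * m)) - ln (1 + t ^ (2 * m)))).

(* [theta] is a diffeomorphism of the interval [I] onto the interval [I']. *)
Definition change_of_parameter (I I' : R -> Prop) (theta : R -> R) : Prop :=
  nonempty_open_interval I' /\
  smooth_on I theta /\
  (forall u, I u -> Derive theta u <> 0) /\
  (forall u w, I u -> I w -> theta u = theta w -> u = w) /\
  (forall s, I' s <-> exists u, I u /\ theta u = s).

(* Main.v *)
Require Import Defs.
From Stdlib Require Import Reals Lra Lia Ranalysis5 ClassicalEpsilon.
From Coquelicot Require Import Coquelicot.
Open Scope R_scope.

(** Let [p] and [w] be the real [(2m-1)]-th roots of [g'] and [h'].  Solving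
    [grad Phi eta = phi (-g', -h', 1)] on the sphere forces
    [eta = N^(-1/(2m)) (-p, -w, 1)] with [N = 1 + p^(2m) + w^(2m)].  The first two
    coordinates of [eta_u] and [eta_v] are their coordinates in the basis
    [(X_u, X_v)], so the trace of [d eta] is [d_u eta_1 + d_v eta_2], and it
    vanishes iff [p' / (1 + p^(2m)) = - w' / (1 + w^(2m))].  The variables separate:
    both sides are a constant [c].  If [c = 0] the slopes are constant and [M] is
    planar; otherwise [F_m(p) = a u + b] and [F_m(w) = - a v + b'] with
    [a = (2m-1) c], and a translation in [u] and [v] removes [b] and [b']. *)

(** * Smooth functions of two variables *)

(** The obstacle is that [minimal] speaks of some smooth [eta]. The sphere equation and the sign of
    [phi] leave one candidate at each point, so [eta] can be replaced by a formula; that formula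
    must then be shown smooth to every order, which is the purpose of the calculus of C^k functions
    below. Here [g'] and [h'] must not vanish: for m >= 2 the odd root is not differentiable at 0.

    The variables separate because of a cancellation in d_u eta_1: differentiating the factor
    N^(-1/(2m)) contributes p^(2m) p', which removes the p-part of N and leaves p' (1 + w^(2m)) as
    the only factor involving derivatives. Dividing the trace by (1 + p^(2m)) (1 + w^(2m)) then
    isolates u from v, and 2m - 1 times each term is the derivative of F_m(p) or F_m(w). Exchanging
    (g, u, a) with (h, v, -a) is a symmetry, so most facts are proved for one half only. *)

Lemma eq_on_interval (I : R -> Prop) (f g df : R -> R) (x y : R) :
  nonempty_open_interval I ->
  (forall z, I z -> is_derive f z (df z)) ->
  (forall z, I z -> is_derive g z (df z)) ->
  I x -> I y -> f x - g x = f y - g y.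
Proof.
  intros (_ & _ & Iconv) Df Dg Ix Iy.
  assert (Iin : forall z, Rmin x y <= z <= Rmax x y -> I z).
  { intros z Hz. unfold Rmin, Rmax in Hz. destruct (Rle_dec x y).
    - apply (Iconv x z y); auto.
    - apply (Iconv y z x); auto. }
  assert (D : forall z, I z -> is_derive (fun t => f t - g t) z (df z - df z)).
  { intros z Iz. apply (is_derive_minus f g); auto. }
  destruct (MVT_gen (fun t => f t - g t) x y (fun z => df z - df z)) as (c & _ & Hc).
  - intros z Hz. apply D, Iin. lra.
  - intros z Hz. apply continuity_pt_filterlim.
    apply (ex_derive_continuous (fun t => f t - g t)). eexists. apply D, Iin, Hz.
  - simpl in Hc. lra.
Qed.

Definition open2 (D : R -> R -> Prop) : Prop :=
  forall u v, D u v -> locally_2d D u v.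

Lemma open2_rect (I J : R -> Prop) : open I -> open J -> open2 (rect I J).
Proof.
  intros OI OJ u v [Iu Jv].
  destruct (OI u Iu) as [d1 H1], (OJ v Jv) as [d2 H2].
  assert (Hd : 0 < Rmin d1 d2) by (apply Rmin_pos; apply cond_pos).
  exists (mkposreal _ Hd). simpl. intros x y Hx Hy. split.
  - apply H1. apply Rlt_le_trans with (1 := Hx). apply Rmin_l.
  - apply H2. apply Rlt_le_trans with (1 := Hy). apply Rmin_r.
Qed.

Lemma locally_slice1 (D : R -> R -> Prop) (u v : R) :
  open2 D -> D u v -> locally u (fun t => D t v).
Proof. intros OD Duv. apply locally_2d_1d_const_y, OD, Duv. Qed.

Lemma locally_slice2 (D : R -> R -> Prop) (u v : R) :
  open2 D -> D u v -> locally v (fun t => D u t).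
Proof. intros OD Duv. apply locally_2d_1d_const_x, OD, Duv. Qed.

(** Agreement on [D] passes to the partial derivatives because [D] is open, so two functions equal
    on [D] agree near each of its points. *)
Lemma Ck2_on_ext (k : nat) (D : R -> R -> Prop) (f g : R -> R -> R) :
  open2 D -> (forall u v, D u v -> f u v = g u v) ->
  Ck2_on k D f -> Ck2_on k D g.
Proof.
  intros OD. revert f g. induction k as [|k IH]; intros f g E [Cf Hf].
  all: assert (Cg : forall u v, D u v -> continuity_2d_pt g u v)
    by (intros u v Duv; apply continuity_2d_pt_ext_loc with f; auto;
        apply locally_2d_impl with (2 := OD u v Duv);
        apply locally_2d_forall; auto).
  - split; auto.
  - split; [exact Cg|]. destruct Hf as (Ef & Fu & Fv).
    assert (E1 : forall u v, D u v -> locally u (fun t => f t v = g t v))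
      by (intros u v Duv; generalize (locally_slice1 D u v OD Duv);
          apply filter_imp; auto).
    assert (E2 : forall u v, D u v -> locally v (fun t => f u t = g u t))
      by (intros u v Duv; generalize (locally_slice2 D u v OD Duv);
          apply filter_imp; auto).
    split; [|split].
    + intros u v Duv. destruct (Ef u v Duv) as [E3 E4]. split.
      * apply ex_derive_ext_loc with (2 := E3); auto.
      * apply ex_derive_ext_loc with (2 := E4); auto.
    + apply IH with (2 := Fu). intros u v Duv. apply Derive_ext_loc; auto.
    + apply IH with (2 := Fv). intros u v Duv. apply Derive_ext_loc; auto.
Qed.

(** Introduction rule: explicit formulas for the partials, valid on [D] only, replace the total
    [Derive] of the definition. Most closure properties below go through it. *)
Lemma Ck2_on_S (k : nat) (D : R -> R -> Prop) (f fu fv : R -> R -> R) :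
  open2 D ->
  (forall u v, D u v -> continuity_2d_pt f u v) ->
  (forall u v, D u v -> is_derive (fun t => f t v) u (fu u v)) ->
  (forall u v, D u v -> is_derive (fun t => f u t) v (fv u v)) ->
  Ck2_on k D fu -> Ck2_on k D fv -> Ck2_on (S k) D f.
Proof.
  intros OD C Du Dv Cu Cv. split; [exact C|]. split; [|split].
  - intros u v Duv. split; eexists; auto.
  - apply Ck2_on_ext with fu; auto.
    intros u v Duv. symmetry. apply is_derive_unique; auto.
  - apply Ck2_on_ext with fv; auto.
    intros u v Duv. symmetry. apply is_derive_unique; auto.
Qed.

Lemma Ck2_on_is_derive1 (k : nat) (D : R -> R -> Prop) (f : R -> R -> R) (u v : R) :
  Ck2_on (S k) D f -> D u v ->
  is_derive (fun t => f t v) u (Derive (fun t => f t v) u).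
Proof. intros (_ & E & _) Duv. apply Derive_correct, (E u v Duv). Qed.

Lemma Ck2_on_is_derive2 (k : nat) (D : R -> R -> Prop) (f : R -> R -> R) (u v : R) :
  Ck2_on (S k) D f -> D u v ->
  is_derive (fun t => f u t) v (Derive (fun t => f u t) v).
Proof. intros (_ & E & _) Duv. apply Derive_correct, (E u v Duv). Qed.

Lemma Ck2_on_continuity (k : nat) (D : R -> R -> Prop) (f : R -> R -> R) :
  Ck2_on k D f -> forall u v, D u v -> continuity_2d_pt f u v.
Proof. destruct k; intros [C _]; exact C. Qed.

(** The product and chain rules keep undifferentiated factors, which are known at order [S k] but
    needed at order [k]. *)
Lemma Ck2_on_pred (k : nat) (D : R -> R -> Prop) (f : R -> R -> R) :
  Ck2_on (S k) D f -> Ck2_on k D f.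
Proof.
  revert f. induction k as [|k IH]; intros f (C & E & Fu & Fv).
  - split; auto.
  - split; [exact C|]. split; [exact E|]. split; apply IH; auto.
Qed.

(** * Closure of the C^k classes under algebra, real powers and exchange of variables *)

Lemma Ck2_on_const (k : nat) (D : R -> R -> Prop) (c : R) :
  open2 D -> Ck2_on k D (fun _ _ => c).
Proof.
  intros OD. revert c. induction k as [|k IH]; intros c.
  - split; auto. intros; apply continuity_2d_pt_const.
  - apply Ck2_on_S with (fun _ _ => 0) (fun _ _ => 0); auto.
    + intros; apply continuity_2d_pt_const.
    + intros; apply (is_derive_const (c : R_NormedModule)).
    + intros; apply (is_derive_const (c : R_NormedModule)).
Qed.

Lemma Ck2_on_plus (k : nat) (D : R -> R -> Prop) (f g : R -> R -> R) :
  open2 D -> Ck2_on k D f -> Ck2_on k D g ->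
  Ck2_on k D (fun u v => f u v + g u v).
Proof.
  intros OD. revert f g. induction k as [|k IH]; intros f g Cf Cg.
  all: assert (C : forall u v, D u v -> continuity_2d_pt (fun u v => f u v + g u v) u v)
    by (intros u v Duv; apply continuity_2d_pt_plus; eapply Ck2_on_continuity; eauto).
  - split; auto.
  - apply Ck2_on_S with
      (fun u v => Derive (fun t => f t v) u + Derive (fun t => g t v) u)
      (fun u v => Derive (fun t => f u t) v + Derive (fun t => g u t) v); auto.
    + intros u v Duv. apply (is_derive_plus (fun t => f t v) (fun t => g t v));
        eapply Ck2_on_is_derive1; eauto.
    + intros u v Duv. apply (is_derive_plus (fun t => f u t) (fun t => g u t));
        eapply Ck2_on_is_derive2; eauto.
    + apply IH; [apply Cf | apply Cg].
    + apply IH; [apply Cf | apply Cg].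
Qed.

Lemma Ck2_on_mult (k : nat) (D : R -> R -> Prop) (f g : R -> R -> R) :
  open2 D -> Ck2_on k D f -> Ck2_on k D g ->
  Ck2_on k D (fun u v => f u v * g u v).
Proof.
  intros OD. revert f g. induction k as [|k IH]; intros f g Cf Cg.
  all: assert (C : forall u v, D u v -> continuity_2d_pt (fun u v => f u v * g u v) u v)
    by (intros u v Duv; apply continuity_2d_pt_mult; eapply Ck2_on_continuity; eauto).
  - split; auto.
  - assert (Cf' := Ck2_on_pred _ _ _ Cf). assert (Cg' := Ck2_on_pred _ _ _ Cg).
    apply Ck2_on_S with
      (fun u v => Derive (fun t => f t v) u * g u v + f u v * Derive (fun t => g t v) u)
      (fun u v => Derive (fun t => f u t) v * g u v + f u v * Derive (fun t => g u t) v);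
      auto.
    + intros u v Duv. apply (is_derive_mult (fun t => f t v) (fun t => g t v));
        [eapply Ck2_on_is_derive1; eauto .. | exact Rmult_comm].
    + intros u v Duv. apply (is_derive_mult (fun t => f u t) (fun t => g u t));
        [eapply Ck2_on_is_derive2; eauto .. | exact Rmult_comm].
    + apply Ck2_on_plus; auto; apply IH; auto; [apply Cf | apply Cg].
    + apply Ck2_on_plus; auto; apply IH; auto; [apply Cf | apply Cg].
Qed.

Lemma Ck2_on_pow (k n : nat) (D : R -> R -> Prop) (f : R -> R -> R) :
  open2 D -> Ck2_on k D f -> Ck2_on k D (fun u v => f u v ^ n).
Proof.
  intros OD Cf. induction n as [|n IH].
  - exact (Ck2_on_const k D 1 OD).
  - apply (Ck2_on_mult k D f (fun u v => f u v ^ n)); auto.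
Qed.

Lemma is_derive_Rpower (f : R -> R) (x df c : R) :
  0 < f x -> is_derive f x df ->
  is_derive (fun t => Rpower (f t) c) x (c * Rpower (f x) (c - 1) * df).
Proof.
  intros Hf Df. rewrite Rmult_comm.
  apply (is_derive_comp (fun y => Rpower y c) f); [|exact Df].
  apply is_derive_Reals, derivable_pt_lim_power, Hf.
Qed.

Lemma Ck2_on_Rpower (k : nat) (c : R) (D : R -> R -> Prop) (f : R -> R -> R) :
  open2 D -> (forall u v, D u v -> 0 < f u v) -> Ck2_on k D f ->
  Ck2_on k D (fun u v => Rpower (f u v) c).
Proof.
  (* The exponent stays general because differentiation lowers it by one. *)
  intros OD Pf. revert c. induction k as [|k IH]; intros c Cf.
  all: assert (C : forall u v, D u v ->
    continuity_2d_pt (fun u v => Rpower (f u v) c) u v)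
    by (intros u v Duv;
        apply (continuity_1d_2d_pt_comp (fun y => Rpower y c));
        [ apply derivable_continuous_pt;
          exists (c * Rpower (f u v) (c - 1)); apply derivable_pt_lim_power; auto
        | eapply Ck2_on_continuity; eauto ]).
  - split; auto.
  - apply Ck2_on_S with
      (fun u v => c * Rpower (f u v) (c - 1) * Derive (fun t => f t v) u)
      (fun u v => c * Rpower (f u v) (c - 1) * Derive (fun t => f u t) v); auto.
    + intros u v Duv. apply (is_derive_Rpower (fun t => f t v)); auto.
      eapply Ck2_on_is_derive1; eauto.
    + intros u v Duv. apply (is_derive_Rpower (fun t => f u t)); auto.
      eapply Ck2_on_is_derive2; eauto.
    + apply Ck2_on_mult; [auto | | apply Cf].
      apply (Ck2_on_mult k D (fun _ _ => c)); [auto | apply Ck2_on_const; auto |].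
      apply IH, Ck2_on_pred, Cf.
    + apply Ck2_on_mult; [auto | | apply Cf].
      apply (Ck2_on_mult k D (fun _ _ => c)); [auto | apply Ck2_on_const; auto |].
      apply IH, Ck2_on_pred, Cf.
Qed.

(** Carries regularity of functions of u over to functions of v. *)
Lemma Ck2_on_swap (k : nat) (I J : R -> Prop) (f : R -> R -> R) :
  Ck2_on k (rect I J) f -> Ck2_on k (rect J I) (fun u v => f v u).
Proof.
  revert f. induction k as [|k IH]; intros f [C Hf].
  all: assert (C' : forall u v, rect J I u v ->
    continuity_2d_pt (fun u v => f v u) u v)
    by (intros u v [Ju Iv] eps; destruct (C v u (conj Iv Ju) eps) as [d Hd];
        exists d; intros x y Hx Hy; apply Hd; auto).
  - split; auto.
  - destruct Hf as (E & Fu & Fv). split; [exact C'|]. split; [|split].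
    + intros u v [Ju Iv]. destruct (E v u (conj Iv Ju)). auto.
    + exact (IH _ Fv).
    + exact (IH _ Fu).
Qed.

Lemma Ck2_on_Derive_n (k n : nat) (I J : R -> Prop) (g : R -> R) :
  open I -> open J -> smooth_on I g ->
  Ck2_on k (rect I J) (fun u _ => Derive_n g n u).
Proof.
  intros OI OJ Sg. revert n. induction k as [|k IH]; intros n.
  all: assert (D : forall u, I u -> is_derive (Derive_n g n) u (Derive_n g (S n) u))
    by (intros u Iu; apply Derive_correct, (Sg (S n) u Iu)).
  all: assert (C : forall u v, rect I J u v ->
    continuity_2d_pt (fun u _ => Derive_n g n u) u v)
    by (intros u v [Iu Jv];
        apply (continuity_1d_2d_pt_comp (Derive_n g n) (fun u _ => u));
        [ apply continuity_pt_filterlim;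
          apply (ex_derive_continuous (Derive_n g n)); eexists; apply D, Iu
        | apply continuity_2d_pt_id1 ]).
  - split; auto.
  - apply Ck2_on_S with (fun u _ => Derive_n g (S n) u) (fun _ _ => 0).
    + apply open2_rect; auto.
    + exact C.
    + intros u v [Iu Jv]. apply D, Iu.
    + intros u v _. apply (is_derive_const (Derive_n g n u : R_NormedModule)).
    + apply IH.
    + apply Ck2_on_const, open2_rect; auto.
Qed.

(** With a dummy second variable, the two-variable calculus also yields smoothness in one variable;
    this serves the new parameters s and t. *)
Lemma Ck2_on_smooth_on (I : R -> Prop) (f : R -> R) :
  (forall k, Ck2_on k (rect I (fun _ => True)) (fun u _ => f u)) ->
  smooth_on I f.
Proof.
  intros Cf n u Iu. specialize (Cf n). revert f Cf.
  induction n as [|n IH]; intros f Cf; [exact Logic.I|].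
  destruct n as [|n].
  - simpl. eexists. apply (Ck2_on_is_derive1 0 _ (fun u _ => f u) u 0 Cf).
    split; auto.
  (* [Ck2_on] peels off the innermost derivative and [Derive_n] the outermost; [Derive_n_comp]
     reconciles the two. *)
  - assert (H := IH (Derive f) (proj1 (proj2 (proj2 Cf)))).
    apply ex_derive_ext with (2 := H). intros t.
    rewrite <- (Nat.add_1_r n). exact (Derive_n_comp f n 1 t).
Qed.

(** * The function [F m] and its inverse *)

Lemma one_plus_even_pow_pos (m : nat) (x : R) : 0 < 1 + x ^ (2 * m).
Proof. rewrite pow_mult. assert (H := pow_le (x ^ 2) m (pow2_ge_0 x)). lra. Qed.

Lemma F_is_derive (m : nat) (s : R) :
  is_derive (F m) s ((2 * INR m - 1) / (1 + s ^ (2 * m))).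
Proof.
  assert (C : forall z, continuous (fun sigma => / (1 + sigma ^ (2 * m))) z).
  { intros z. apply (ex_derive_continuous (fun sigma => / (1 + sigma ^ (2 * m)))).
    auto_derive. apply Rgt_not_eq, (one_plus_even_pow_pos m z). }
  apply (is_derive_scal (fun s => RInt (fun sigma => / (1 + sigma ^ (2 * m))) 0 s)).
  apply (is_derive_RInt (fun sigma => / (1 + sigma ^ (2 * m)))) with (a := 0); [|apply C].
  apply filter_forall. intros b. apply (RInt_correct (V := R_CompleteNormedModule)).
  apply (ex_RInt_continuous (V := R_CompleteNormedModule)). auto.
Qed.

Lemma F_speed_pos (m : nat) (s : R) :
  (1 <= m)%nat -> 0 < (2 * INR m - 1) / (1 + s ^ (2 * m)).
Proof.
  intros Hm. apply le_INR in Hm. simpl in Hm.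
  apply Rdiv_lt_0_compat; [lra | apply one_plus_even_pow_pos].
Qed.

Lemma F_continuity_pt (m : nat) (s : R) : continuity_pt (F m) s.
Proof.
  apply continuity_pt_filterlim, (ex_derive_continuous (F m)).
  eexists. apply F_is_derive.
Qed.

Lemma F_increasing (m : nat) (x y : R) : (1 <= m)%nat -> x < y -> F m x < F m y.
Proof.
  intros Hm Hxy.
  destruct (MVT_gen (F m) x y (fun s => (2 * INR m - 1) / (1 + s ^ (2 * m))))
    as (c & _ & Hc).
  - intros s _. apply F_is_derive.
  - intros s _. apply F_continuity_pt.
  - assert (H := Rmult_lt_0_compat _ (y - x) (F_speed_pos m c Hm)). lra.
Qed.

Lemma F_injective (m : nat) (x y : R) : (1 <= m)%nat -> F m x = F m y -> x = y.
Proof.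
  intros Hm E. destruct (Rtotal_order x y) as [L | [-> | L]]; [| reflexivity |];
    apply (F_increasing m) in L; lra || exact Hm.
Qed.

Lemma F_0 (m : nat) : F m 0 = 0.
Proof. unfold F. rewrite RInt_point. apply Rmult_0_r. Qed.

Lemma F_Finv (m : nat) (y : R) : F_range m y -> F m (Finv m y) = y.
Proof. apply (epsilon_spec (inhabits 0) (fun s => F m s = y)). Qed.

Lemma Finv_F (m : nat) (s : R) : (1 <= m)%nat -> Finv m (F m s) = s.
Proof.
  intros Hm. apply (F_injective m _ _ Hm), F_Finv. exists s; reflexivity.
Qed.

(** By the intermediate value theorem the range is an interval, so its end points never have to be
    computed. *)
Lemma F_range_between (m : nat) (s t y : R) :
  F m s <= y <= F m t -> F_range m y.
Proof.
  intros H. destruct (IVT_gen (F m) s t y) as (x & _ & Hx).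
  - intros x. apply F_continuity_pt.
  - unfold Rmin, Rmax. destruct (Rle_dec (F m s) (F m t)); lra.
  - exists x; exact Hx.
Qed.

(** Inverse function theorem on the bracket from F_m(s - 1) to F_m(s + 1), which contains F_m(s) in
    its interior since F_m increases strictly. *)
Lemma Finv_is_derive (m : nat) (y : R) :
  (1 <= m)%nat -> F_range m y ->
  is_derive (Finv m) y ((1 + Finv m y ^ (2 * m)) / (2 * INR m - 1)).
Proof.
  intros Hm [s <-].
  set (a := F m (s - 1)). set (b := F m (s + 1)).
  assert (Hab : a < F m s < b) by (split; apply F_increasing; auto; lra).
  assert (Rg : forall z, a <= z <= b -> F_range m z)
    by (intros z; apply F_range_between).
  assert (Ca : Finv m a = s - 1) by (apply Finv_F; auto).
  assert (Cb : Finv m b = s + 1) by (apply Finv_F; auto).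
  (* [Finv] is defined by choice, so its values on the bracket are located through the monotonicity
     of [F m]. *)
  assert (W : forall z, a <= z <= b -> s - 1 <= Finv m z <= s + 1).
  { intros z Hz. assert (E := F_Finv m z (Rg z Hz)). split.
    - destruct (Rle_lt_dec (s - 1) (Finv m z)) as [L | L]; [exact L |].
      apply (F_increasing m _ _ Hm) in L. fold a in L. lra.
    - destruct (Rle_lt_dec (Finv m z) (s + 1)) as [L | L]; [exact L |].
      apply (F_increasing m _ _ Hm) in L. fold b in L. lra. }
  assert (C : continuity_pt (Finv m) (F m s)).
  { apply continuity_pt_recip_interv with (F m) (s - 1) (s + 1); auto; try lra.
    - intros x z _ L _. apply F_increasing; auto.
    - intros z H1 H2. apply F_Finv, Rg. auto.
    - intros z _. apply F_continuity_pt. }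
  assert (Prf : forall z, Finv m a <= z <= Finv m b -> derivable_pt (F m) z).
  { intros z _. apply ex_derive_Reals_0. eexists. apply F_is_derive. }
  assert (Hi : Finv m a <= Finv m (F m s) <= Finv m b)
    by (rewrite Ca, Cb; apply W; lra).
  assert (E : derive_pt (F m) (Finv m (F m s)) (Prf _ Hi) =
              (2 * INR m - 1) / (1 + Finv m (F m s) ^ (2 * m))).
  { rewrite Derive_Reals. apply is_derive_unique, F_is_derive. }
  assert (P := F_speed_pos m (Finv m (F m s)) Hm).
  assert (H := derivable_pt_lim_recip_interv (F m) (Finv m) a b (F m s) Prf C
    ltac:(lra) Hab Hi).
  rewrite E in H. apply is_derive_Reals.
  replace ((1 + Finv m (F m s) ^ (2 * m)) / (2 * INR m - 1))
    with (1 / ((2 * INR m - 1) / (1 + Finv m (F m s) ^ (2 * m)))).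
  - apply H; [|lra]. intros z Hz. apply F_Finv, Rg, Hz.
  - apply le_INR in Hm. simpl in Hm. field.
    generalize (one_plus_even_pow_pos m (Finv m (F m s))). split; lra.
Qed.

(** * Odd roots and slopes *)

(* The real odd root [y^(1/(2m-1))] for [y <> 0]; writing it as
   [y * (y^2)^e] avoids a case distinction on the sign of [y]. *)
Definition odd_root (m : nat) (y : R) : R :=
  y * Rpower (y ^ 2) (/ 2 * (/ (2 * INR m - 1) - 1)).

Lemma sq_pos (y : R) : y <> 0 -> 0 < y ^ 2.
Proof. intros Hy. rewrite <- Rsqr_pow2. apply Rsqr_pos_lt, Hy. Qed.

(** y^(2m-1) is y times (y^2)^(m-1), and the second factor strips the even part. Both inversion laws
    for [odd_root] reduce to this, since the exponent in [odd_root] times 2m - 1 is 1 - m. *)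
Lemma odd_pow_Rpower (m : nat) (y : R) :
  (1 <= m)%nat -> y <> 0 ->
  y ^ (2 * m - 1) * Rpower (y ^ 2) (1 - INR m) = y.
Proof.
  intros Hm Hy. destruct m as [|k]; [lia|].
  replace (2 * S k - 1)%nat with (S (2 * k)) by lia.
  rewrite S_INR. replace (1 - (INR k + 1)) with (- INR k) by ring.
  rewrite Rpower_Ropp, Rpower_pow, <- pow_mult by (apply sq_pos, Hy).
  rewrite <- tech_pow_Rmult. field. apply pow_nonzero, Hy.
Qed.

Lemma INR_odd (m : nat) : (1 <= m)%nat -> INR (2 * m - 1) = 2 * INR m - 1.
Proof. intros Hm. rewrite minus_INR, mult_INR by lia. simpl. ring. Qed.

Lemma odd_root_pow (m : nat) (y : R) :
  (1 <= m)%nat -> y <> 0 -> odd_root m y ^ (2 * m - 1) = y.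
Proof.
  intros Hm Hy. unfold odd_root. rewrite Rpow_mult_distr.
  rewrite <- (Rpower_pow (2 * m - 1) (Rpower _ _)) by apply exp_pos.
  rewrite Rpower_mult, INR_odd by exact Hm.
  rewrite <- (odd_pow_Rpower m y Hm Hy) at 3. f_equal. f_equal.
  apply le_INR in Hm. simpl in Hm. field. lra.
Qed.

Lemma pow_odd_root (m : nat) (x : R) :
  (1 <= m)%nat -> x <> 0 -> odd_root m (x ^ (2 * m - 1)) = x.
Proof.
  intros Hm Hx. unfold odd_root.
  rewrite <- pow_mult, (Nat.mul_comm (2 * m - 1) 2), pow_mult.
  rewrite <- (Rpower_pow (2 * m - 1) (x ^ 2)) by (apply sq_pos, Hx).
  rewrite Rpower_mult, INR_odd by exact Hm.
  rewrite <- (odd_pow_Rpower m x Hm Hx) at 3. f_equal. f_equal.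
  apply le_INR in Hm. simpl in Hm. field. lra.
Qed.

Lemma odd_root_neq_0 (m : nat) (y : R) : y <> 0 -> odd_root m y <> 0.
Proof.
  intros Hy. apply Rmult_integral_contrapositive_currified; [exact Hy|].
  apply Rgt_not_eq, exp_pos.
Qed.

(* For the graph of [g], the ratio [- eta_1 / eta_3] of the Birkhoff-Gauss map. *)
Definition slope (m : nat) (g : R -> R) (u : R) : R := odd_root m (Derive g u).

(** Since g' does not vanish, the base (g')^2 of the real power in [odd_root] is positive, where
    [Rpower] is smooth. *)
Lemma Ck2_on_slope (k m : nat) (I J : R -> Prop) (g : R -> R) :
  open I -> open J -> smooth_on I g -> (forall u, I u -> Derive g u <> 0) ->
  Ck2_on k (rect I J) (fun u _ => slope m g u).
Proof.
  intros OI OJ Sg Ng. assert (O := open2_rect I J OI OJ).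
  assert (C := Ck2_on_Derive_n k 1 I J g OI OJ Sg).
  apply (Ck2_on_mult k _ (fun u _ => Derive g u)); [exact O | exact C |].
  apply (Ck2_on_Rpower k _ _ (fun u _ => Derive g u ^ 2)); [exact O | |].
  - intros u v [Iu _]. apply sq_pos, Ng, Iu.
  - apply (Ck2_on_pow k 2 _ (fun u _ => Derive g u)); auto.
Qed.

Lemma slope_is_derive (m : nat) (I : R -> Prop) (g : R -> R) (u : R) :
  open I -> smooth_on I g -> (forall u, I u -> Derive g u <> 0) -> I u ->
  is_derive (slope m g) u (Derive (slope m g) u).
Proof.
  intros OI Sg Ng Iu.
  apply (Ck2_on_is_derive1 0 (rect I (fun _ => True)) (fun u _ => slope m g u) u 0).
  - apply Ck2_on_slope; auto. apply open_true.
  - split; auto.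
Qed.

(** * The Birkhoff-Gauss map of a graph *)

Lemma scal_R3 (a x y z : R) : scal a ((x, y, z) : R3) = (a * x, a * y, a * z).
Proof. reflexivity. Qed.

Lemma plus_R3 (x y z x' y' z' : R) :
  plus ((x, y, z) : R3) (x', y', z') = (x + x', y + y', z + z').
Proof. reflexivity. Qed.

Lemma grad_Phi (m : nat) (x : R3) :
  grad (Phi m) x =
  scal (2 * INR m) (x1 x ^ (2 * m - 1), x2 x ^ (2 * m - 1), x3 x ^ (2 * m - 1)).
Proof.
  assert (D : forall t, is_derive (fun s => s ^ (2 * m)) t
                          (2 * INR m * t ^ (2 * m - 1))).
  { intros t. apply is_derive_Reals. replace (2 * INR m) with (INR (2 * m)).
    - rewrite Nat.sub_1_r. apply derivable_pt_lim_pow.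
    - rewrite mult_INR. reflexivity. }
  rewrite scal_R3. unfold grad, Phi. simpl x1. simpl x2. simpl x3.
  (* Along each axis [Phi] is t^(2m) plus a constant; [P] discards the constant for all three
     coordinates at once. *)
  assert (P : forall f g : R -> R, forall t l, is_derive f t l ->
     (forall s, g s = g t + (f s - f t)) -> Derive g t = l).
  { intros f g t l Df E. apply is_derive_unique.
    apply is_derive_ext with (fun s => (g t - f t) + f s).
    - intros s. rewrite (E s). simpl. ring.
    - rewrite <- (Rplus_0_l l).
      apply (is_derive_plus (fun _ => g t - f t) f); [|exact Df].
      apply (is_derive_const (g t - f t : R_NormedModule)). }
  f_equal; [f_equal|]; (apply (P (fun s => s ^ (2 * m))); [apply D |]);
    intros; unfold x1, x2, x3; cbn [fst snd]; ring.
Qed.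

Lemma du_translation_surface (g h : R -> R) (u v : R) :
  ex_derive g u -> du (translation_surface g h) u v = (1, 0, Derive g u).
Proof.
  intros Eg. unfold du, translation_surface, x1, x2, x3. simpl.
  rewrite Derive_id, Derive_const. f_equal. apply is_derive_unique.
  rewrite <- (Rplus_0_r (Derive g u)).
  apply (is_derive_plus g (fun _ => h v)); [apply Derive_correct, Eg |].
  apply (is_derive_const (h v : R_NormedModule)).
Qed.

Lemma dv_translation_surface (g h : R -> R) (u v : R) :
  ex_derive h v -> dv (translation_surface g h) u v = (0, 1, Derive h v).
Proof.
  intros Eh. unfold dv, translation_surface, x1, x2, x3. simpl.
  rewrite Derive_id, Derive_const. f_equal. apply is_derive_unique.
  rewrite <- (Rplus_0_l (Derive h v)).
  apply (is_derive_plus (fun _ => g u) h); [|apply Derive_correct, Eh].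
  apply (is_derive_const (g u : R_NormedModule)).
Qed.

Lemma graph_normal (p w : R) : cross (1, 0, p) (0, 1, w) = (- p, - w, 1).
Proof. unfold cross, x1, x2, x3. simpl. f_equal; [f_equal|]; ring. Qed.

Lemma graph_tangent (p w a b : R) :
  plus (scal a ((1, 0, p) : R3)) (scal b ((0, 1, w) : R3)) = (a, b, a * p + b * w).
Proof. rewrite !scal_R3, plus_R3. f_equal. f_equal; ring. Qed.

Lemma opp_odd_pow (m : nat) (x : R) :
  (1 <= m)%nat -> (- x) ^ (2 * m - 1) = - x ^ (2 * m - 1).
Proof.
  intros Hm. destruct m as [|k]; [lia|].
  replace (2 * S k - 1)%nat with (S (2 * k)) by lia.
  rewrite <- !tech_pow_Rmult, !pow_mult. replace ((- x) ^ 2) with (x ^ 2) by ring. ring.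
Qed.

Lemma odd_pow_pos_rev (m : nat) (x : R) :
  (1 <= m)%nat -> 0 < x ^ (2 * m - 1) -> 0 < x.
Proof.
  intros Hm. destruct m as [|k]; [lia|].
  replace (2 * S k - 1)%nat with (S (2 * k)) by lia.
  rewrite <- tech_pow_Rmult, pow_mult. intros H.
  assert (H2 := pow_le (x ^ 2) k (pow2_ge_0 x)).
  destruct (Rle_lt_dec x 0) as [L | L]; [|exact L].
  assert (x * (x ^ 2) ^ k <= 0); [|lra].
  rewrite <- (Rmult_0_l ((x ^ 2) ^ k)). apply Rmult_le_compat_r; auto.
Qed.

Lemma even_pow_split (m : nat) (x : R) :
  (1 <= m)%nat -> x ^ (2 * m) = x * x ^ (2 * m - 1).
Proof. intros Hm. rewrite tech_pow_Rmult. f_equal. lia. Qed.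

(** * The explicit Birkhoff-Gauss map: uniqueness and existence *)

Definition gauss_denom (m : nat) (g h : R -> R) (u v : R) : R :=
  1 + slope m h v ^ (2 * m) + slope m g u ^ (2 * m).

Definition gauss_scale (m : nat) (g h : R -> R) (u v : R) : R :=
  Rpower (gauss_denom m g h u v) (- / (2 * INR m)).

(* Solving [grad Phi eta = phi (-g', -h', 1)] on the unit sphere. *)
Definition gauss (m : nat) (g h : R -> R) (u v : R) : R3 :=
  let mu := gauss_scale m g h u v in
  (mu * - slope m g u, mu * - slope m h v, mu).

Lemma gauss_denom_pos (m : nat) (g h : R -> R) (u v : R) :
  0 < gauss_denom m g h u v.
Proof.
  unfold gauss_denom. generalize (one_plus_even_pow_pos m (slope m h v)).
  rewrite (pow_mult (slope m g u)).
  generalize (pow_le (slope m g u ^ 2) m (pow2_ge_0 _)). lra.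
Qed.

Lemma gauss_scale_pos (m : nat) (g h : R -> R) (u v : R) : 0 < gauss_scale m g h u v.
Proof. apply exp_pos. Qed.

Lemma gauss_scale_pow (m : nat) (g h : R -> R) (u v : R) :
  (1 <= m)%nat -> gauss_scale m g h u v ^ (2 * m) = / gauss_denom m g h u v.
Proof.
  intros Hm. rewrite <- Rpower_pow by apply gauss_scale_pos.
  unfold gauss_scale. rewrite Rpower_mult, mult_INR.
  apply le_INR in Hm. simpl in Hm.
  replace (- / (2 * INR m) * (INR 2 * INR m)) with (Ropp 1) by (simpl; field; lra).
  rewrite Rpower_Ropp, Rpower_1; [reflexivity | apply gauss_denom_pos].
Qed.

(** The third equation gives e3 > 0, as an odd power has the sign of its base. Dividing the other
    two by it eliminates [phi], and taking odd roots gives e1 = - p e3 and e2 = - w e3. The sphere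
    equation becomes e3^(2m) N = 1, which fixes e3. *)
Lemma gauss_unique (m : nat) (g h : R -> R) (u v phi : R) (eta : R3) :
  (1 <= m)%nat -> Derive g u <> 0 -> Derive h v <> 0 ->
  unit_sphere m eta -> 0 < phi ->
  grad (Phi m) eta = scal phi ((- Derive g u, - Derive h v, 1) : R3) ->
  eta = gauss m g h u v.
Proof.
  intros Hm Ng Nh S Hphi. destruct eta as [[e1 e2] e3].
  unfold unit_sphere, Phi in S. rewrite grad_Phi, !scal_R3.
  unfold x1, x2, x3 in *. cbn [fst snd] in *. intros E.
  apply pair_equal_spec in E as [E E3]. apply pair_equal_spec in E as [E1 E2].
  assert (Hm' := le_INR _ _ Hm). simpl in Hm'.
  assert (P3 : 0 < e3).
  { apply (odd_pow_pos_rev m); [exact Hm|].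
    apply Rmult_lt_reg_l with (2 * INR m); lra. }
  assert (Q3 := pow_lt e3 (2 * m - 1) P3).
  assert (Sl : forall f e x, Derive f x <> 0 ->
     2 * INR m * e ^ (2 * m - 1) = phi * - Derive f x -> e = e3 * - slope m f x).
  { intros f e x Nf Ef.
    assert (Hd : (- e / e3) ^ (2 * m - 1) = Derive f x).
    { unfold Rdiv. rewrite Rpow_mult_distr, opp_odd_pow, pow_inv by exact Hm.
      apply Rmult_eq_reg_r with (2 * INR m * e3 ^ (2 * m - 1)); [|apply Rgt_not_eq, Rmult_lt_0_compat; lra].
      replace (- e ^ (2 * m - 1) * / e3 ^ (2 * m - 1) * (2 * INR m * e3 ^ (2 * m - 1)))
        with (- (2 * INR m * e ^ (2 * m - 1))) by (field; apply Rgt_not_eq, Q3).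
      rewrite Ef, E3. ring. }
    unfold slope. rewrite <- Hd, pow_odd_root; [field; lra | exact Hm |].
    intros H0. apply Nf. rewrite <- Hd, H0. apply pow_i. lia. }
  assert (F1 := Sl g e1 u Ng E1). assert (F2 := Sl h e2 v Nh E2).
  assert (E4 : e3 = gauss_scale m g h u v).
  { unfold gauss_scale. replace (gauss_denom m g h u v) with (/ e3 ^ (2 * m)).
    - rewrite <- (Rpower_pow (2 * m) e3), <- Rpower_Ropp, Rpower_mult, mult_INR by exact P3.
      replace (- (INR 2 * INR m) * - / (2 * INR m)) with 1 by (simpl; field; lra).
      rewrite Rpower_1; auto.
    - assert (P := pow_lt e3 (2 * m) P3).
      apply Rmult_eq_reg_l with (e3 ^ (2 * m)); [|lra].
      rewrite Rinv_r by lra. rewrite <- S, F1, F2. unfold gauss_denom.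
      rewrite !Rpow_mult_distr, !(pow_mult (- _)).
      replace ((- slope m g u) ^ 2) with (slope m g u ^ 2) by ring.
      replace ((- slope m h v) ^ 2) with (slope m h v ^ 2) by ring.
      rewrite <- !pow_mult. ring. }
  unfold gauss. rewrite <- E4, <- F1, <- F2. reflexivity.
Qed.

Lemma gauss_grad (m : nat) (g h : R -> R) (u v : R) :
  (1 <= m)%nat -> Derive g u <> 0 -> Derive h v <> 0 ->
  grad (Phi m) (gauss m g h u v) =
  scal (2 * INR m * gauss_scale m g h u v ^ (2 * m - 1))
    ((- Derive g u, - Derive h v, 1) : R3).
Proof.
  intros Hm Ng Nh. rewrite grad_Phi, !scal_R3. unfold gauss, x1, x2, x3, slope.
  cbn [fst snd].
  rewrite !Rpow_mult_distr, !opp_odd_pow, !odd_root_pow by assumption.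
  f_equal; [f_equal|]; ring.
Qed.

Lemma gauss_unit_sphere (m : nat) (g h : R -> R) (u v : R) :
  (1 <= m)%nat -> unit_sphere m (gauss m g h u v).
Proof.
  intros Hm. unfold unit_sphere, Phi, gauss, x1, x2, x3. cbn [fst snd].
  rewrite !Rpow_mult_distr, !(pow_mult (- _)).
  replace ((- slope m g u) ^ 2) with (slope m g u ^ 2) by ring.
  replace ((- slope m h v) ^ 2) with (slope m h v ^ 2) by ring.
  rewrite <- !(pow_mult (slope _ _ _)), gauss_scale_pow by exact Hm.
  assert (P := gauss_denom_pos m g h u v).
  apply Rmult_eq_reg_l with (gauss_denom m g h u v); [|lra].
  unfold gauss_denom in *. field. lra.
Qed.

Lemma Ck2_on_gauss_scale (k m : nat) (I J : R -> Prop) (g h : R -> R) :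
  open I -> open J -> smooth_on I g -> smooth_on J h ->
  (forall u, I u -> Derive g u <> 0) -> (forall v, J v -> Derive h v <> 0) ->
  Ck2_on k (rect I J) (gauss_scale m g h).
Proof.
  intros OI OJ Sg Sh Ng Nh. assert (O := open2_rect I J OI OJ).
  apply (Ck2_on_Rpower k _ (rect I J) (gauss_denom m g h)); [exact O | |].
  - intros u v _. apply gauss_denom_pos.
  - apply (Ck2_on_plus k _ (fun u v => 1 + slope m h v ^ (2 * m))
             (fun u _ => slope m g u ^ (2 * m))); [exact O | |].
    + apply (Ck2_on_plus k _ (fun _ _ => 1) (fun _ v => slope m h v ^ (2 * m)));
        [exact O | apply Ck2_on_const; exact O |].
      apply (Ck2_on_pow k (2 * m) _ (fun _ v => slope m h v)); [exact O|].
      apply (Ck2_on_swap k J I (fun v _ => slope m h v)), Ck2_on_slope; auto.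
    + apply (Ck2_on_pow k (2 * m) _ (fun u _ => slope m g u)); [exact O|].
      apply Ck2_on_slope; auto.
Qed.

Lemma smooth_on_is_derive (I : R -> Prop) (g : R -> R) (u : R) :
  smooth_on I g -> I u -> is_derive g u (Derive g u).
Proof. intros Sg Iu. apply Derive_correct, (Sg 1%nat u Iu). Qed.

Lemma gauss_is_birkhoff_gauss_map (m : nat) (I J : R -> Prop) (g h : R -> R) :
  (1 <= m)%nat -> open I -> open J -> smooth_on I g -> smooth_on J h ->
  (forall u, I u -> Derive g u <> 0) -> (forall v, J v -> Derive h v <> 0) ->
  birkhoff_gauss_map m (rect I J) (translation_surface g h) (gauss m g h).
Proof.
  intros Hm OI OJ Sg Sh Ng Nh. assert (O := open2_rect I J OI OJ).
  assert (Hm' := le_INR _ _ Hm). simpl in Hm'. split.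
  - intros k. assert (Cmu := Ck2_on_gauss_scale k m I J g h OI OJ Sg Sh Ng Nh).
    split; [|split; [|exact Cmu]].
    + apply (Ck2_on_ext k _ (fun u v => -1 * (gauss_scale m g h u v * slope m g u)));
        [exact O | intros u v _; unfold gauss, x1; simpl; ring |].
      apply (Ck2_on_mult k _ (fun _ _ => -1)); [exact O | apply Ck2_on_const, O |].
      apply (Ck2_on_mult k _ (gauss_scale m g h) (fun u _ => slope m g u)); auto.
      apply Ck2_on_slope; auto.
    + apply (Ck2_on_ext k _ (fun u v => -1 * (gauss_scale m g h u v * slope m h v)));
        [exact O | intros u v _; unfold gauss, x2; simpl; ring |].
      apply (Ck2_on_mult k _ (fun _ _ => -1)); [exact O | apply Ck2_on_const, O |].
      apply (Ck2_on_mult k _ (gauss_scale m g h) (fun _ v => slope m h v)); auto.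
      apply (Ck2_on_swap k J I (fun v _ => slope m h v)), Ck2_on_slope; auto.
  - intros u v [Iu Jv].
    assert (Eg : ex_derive g u) by apply (Sg 1%nat u Iu).
    assert (Eh : ex_derive h v) by apply (Sh 1%nat v Jv).
    assert (Gr := gauss_grad m g h u v Hm (Ng u Iu) (Nh v Jv)).
    assert (Pmu := gauss_scale_pos m g h u v).
    assert (Pphi : 0 < 2 * INR m * gauss_scale m g h u v ^ (2 * m - 1))
      by (apply Rmult_lt_0_compat; [lra | apply pow_lt, Pmu]).
    split; [|split].
    + apply gauss_unit_sphere, Hm.
    + split.
      * intros E. apply (f_equal x3) in E. unfold gauss, x3 in E. simpl in E.
        change (gauss_scale m g h u v = 0) in E. lra.
      * intros w.
        (* Normalising does nothing to a point of the sphere, where the norm is a power of 1. *)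
        assert (E : scal (/ norm2m m (gauss m g h u v)) (gauss m g h u v) =
                    gauss m g h u v).
        { replace (norm2m m (gauss m g h u v)) with 1.
          - rewrite Rinv_1. apply (scal_one (gauss m g h u v)).
          - unfold norm2m. rewrite (gauss_unit_sphere m g h u v Hm).
            destruct (Req_EM_T 1 0) as [H | _]; [lra|].
            unfold Rpower. rewrite ln_1, Rmult_0_r, exp_0. reflexivity. }
        unfold sphere_tangent, tangent_plane. rewrite E, Gr.
        rewrite du_translation_surface, dv_translation_surface by assumption.
        destruct w as [[w1 w2] w3]. rewrite scal_R3.
        unfold dot, x1, x2, x3. cbn [fst snd].
        set (phi := 2 * INR m * gauss_scale m g h u v ^ (2 * m - 1)) in *.
        split.
        (* Tangency reads phi (w3 - g' w1 - h' w2) = 0, so w3 is determined and w1, w2 are the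
           coefficients in the basis. *)
        -- intros H. exists w1, w2. rewrite graph_tangent. f_equal.
           apply Rmult_eq_reg_l with phi; [lra | apply Rgt_not_eq, Pphi].
        -- intros (a & b & Hw). rewrite graph_tangent in Hw.
           apply pair_equal_spec in Hw as [Hw ->].
           apply pair_equal_spec in Hw as [-> ->]. ring.
    + exists (2 * INR m * gauss_scale m g h u v ^ (2 * m - 1)). split; [exact Pphi|].
      rewrite du_translation_surface, dv_translation_surface, graph_normal by assumption.
      exact Gr.
Qed.

(** Makes the existential quantifier of [minimal] harmless: any admissible [eta] coincides on [D]
    with the explicit map. *)
Lemma birkhoff_gauss_map_unique (m : nat) (D : R -> R -> Prop) (g h : R -> R)
    (eta : R -> R -> R3) (u v : R) :
  (1 <= m)%nat -> birkhoff_gauss_map m D (translation_surface g h) eta -> D u v ->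
  ex_derive g u -> ex_derive h v -> Derive g u <> 0 -> Derive h v <> 0 ->
  eta u v = gauss m g h u v.
Proof.
  intros Hm [_ H] Duv Eg Eh Ng Nh. destruct (H u v Duv) as (S & _ & phi & P & G).
  rewrite du_translation_surface, dv_translation_surface, graph_normal in G by assumption.
  exact (gauss_unique m g h u v phi _ Hm Ng Nh S P G).
Qed.

(** * The differential of the Birkhoff-Gauss map and its trace *)

(** Logarithmic derivative of mu = N^(-1/(2m)): mu_u / mu = - N_u / (2m N), and N_u = 2m p^(2m-1) p'
    cancels the 2m. *)
Lemma gauss_scale_is_derive (m : nat) (g h : R -> R) (u v dp : R) :
  (1 <= m)%nat -> is_derive (slope m g) u dp ->
  is_derive (fun t => gauss_scale m g h t v) u
    (- (gauss_scale m g h u v * slope m g u ^ (2 * m - 1) * dp / gauss_denom m g h u v)).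
Proof.
  intros Hm Dp. assert (P := gauss_denom_pos m g h u v).
  assert (Dd : is_derive (fun t => gauss_denom m g h t v) u
                 (2 * INR m * slope m g u ^ (2 * m - 1) * dp)).
  { unfold gauss_denom. auto_derive; [eexists; exact Dp|].
    replace (Derive (fun t => slope m g t) u) with dp
      by (symmetry; apply is_derive_unique, Dp).
    change (m + (m + 0))%nat with (2 * m)%nat. rewrite <- Nat.sub_1_r, mult_INR.
    simpl INR. ring. }
  assert (H := is_derive_Rpower _ u _ (- / (2 * INR m)) P Dd).
  apply le_INR in Hm. simpl in Hm.
  replace (- (gauss_scale m g h u v * slope m g u ^ (2 * m - 1) * dp / gauss_denom m g h u v))
    with (- / (2 * INR m) * Rpower (gauss_denom m g h u v) (- / (2 * INR m) - 1) *
          (2 * INR m * slope m g u ^ (2 * m - 1) * dp)); [exact H|].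
  unfold gauss_scale, Rminus. rewrite Rpower_plus, (Rpower_Ropp _ 1), Rpower_1 by exact P.
  field. lra.
Qed.

Lemma gauss_is_derive (m : nat) (g h : R -> R) (u v dp : R) :
  (1 <= m)%nat -> is_derive (slope m g) u dp ->
  let mu := gauss_scale m g h u v in
  let N := gauss_denom m g h u v in
  let p := slope m g u in
  let w := slope m h v in
  is_derive (fun t => x1 (gauss m g h t v)) u (- (mu * dp * (1 + w ^ (2 * m)) / N)) /\
  is_derive (fun t => x2 (gauss m g h t v)) u (mu * p ^ (2 * m - 1) * dp * w / N) /\
  is_derive (fun t => x3 (gauss m g h t v)) u (- (mu * p ^ (2 * m - 1) * dp / N)).
Proof.
  intros Hm Dp mu N p w.
  assert (P : 0 < N) by apply gauss_denom_pos.
  assert (Dmu := gauss_scale_is_derive m g h u v dp Hm Dp). fold mu p N in Dmu.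
  split; [|split].
  - replace (- (mu * dp * (1 + w ^ (2 * m)) / N))
      with (- (mu * p ^ (2 * m - 1) * dp / N) * - p + mu * - dp).
    + apply (is_derive_mult (fun t => gauss_scale m g h t v) (fun t => - slope m g t));
        [exact Dmu | | exact Rmult_comm].
      apply (is_derive_opp (slope m g)), Dp.
    (* The cancellation that later separates the variables: the p-part of [N] drops out. *)
    + assert (E : 1 + w ^ (2 * m) = N - p * p ^ (2 * m - 1)).
      { rewrite <- even_pow_split by exact Hm. unfold N, gauss_denom. fold p w. ring. }
      rewrite E. field. lra.
  - replace (mu * p ^ (2 * m - 1) * dp * w / N)
      with (- (mu * p ^ (2 * m - 1) * dp / N) * - w + mu * 0) by (field; lra).
    apply (is_derive_mult (fun t => gauss_scale m g h t v) (fun _ => - slope m h v));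
      [exact Dmu | | exact Rmult_comm].
    apply (is_derive_const (- slope m h v : R_NormedModule)).
  - exact Dmu.
Qed.

(** By this symmetry the v-derivatives are instances of [gauss_is_derive] with [g] and [h]
    exchanged. *)
Lemma gauss_swap (m : nat) (g h : R -> R) (u v : R) :
  x1 (gauss m g h u v) = x2 (gauss m h g v u) /\
  x2 (gauss m g h u v) = x1 (gauss m h g v u) /\
  x3 (gauss m g h u v) = x3 (gauss m h g v u).
Proof.
  assert (E : gauss_scale m g h u v = gauss_scale m h g v u).
  { unfold gauss_scale. f_equal. unfold gauss_denom. ring. }
  unfold gauss, x1, x2, x3. simpl. rewrite E. auto.
Qed.

Lemma minimal_translation_surface (m : nat) (I J : R -> Prop) (g h : R -> R) :
  (1 <= m)%nat -> open I -> open J -> smooth_on I g -> smooth_on J h ->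
  (forall u, I u -> Derive g u <> 0) -> (forall v, J v -> Derive h v <> 0) ->
  minimal m (rect I J) (translation_surface g h) <->
  forall u v, I u -> J v ->
    Derive (slope m g) u / (1 + slope m g u ^ (2 * m)) =
    - (Derive (slope m h) v / (1 + slope m h v ^ (2 * m))).
Proof.
  intros Hm OI OJ Sg Sh Ng Nh. assert (O := open2_rect I J OI OJ).
  assert (Main : forall u v, I u -> J v ->
    let p := slope m g u in let w := slope m h v in
    let dp := Derive (slope m g) u in let dw := Derive (slope m h) v in
    exists b c,
    du (gauss m g h) u v =
      plus (scal (- (gauss_scale m g h u v * dp * (1 + w ^ (2 * m)) / gauss_denom m g h u v))
             (du (translation_surface g h) u v))
           (scal b (dv (translation_surface g h) u v)) /\
    dv (gauss m g h) u v =
      plus (scal c (du (translation_surface g h) u v))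
           (scal (- (gauss_scale m g h u v * dw * (1 + p ^ (2 * m)) / gauss_denom m g h u v))
             (dv (translation_surface g h) u v))).
  { intros u v Iu Jv p w dp dw.
    assert (Dp := slope_is_derive m I g u OI Sg Ng Iu).
    assert (Dw := slope_is_derive m J h v OJ Sh Nh Jv).
    destruct (gauss_is_derive m g h u v dp Hm Dp) as (G1 & G2 & G3).
    destruct (gauss_is_derive m h g v u dw Hm Dw) as (H1 & H2 & H3).
    fold p w in G1, G2, G3, H1, H2, H3.
    assert (EN : gauss_denom m h g v u = gauss_denom m g h u v)
      by (unfold gauss_denom; ring).
    assert (Emu : gauss_scale m h g v u = gauss_scale m g h u v)
      by (unfold gauss_scale; rewrite EN; reflexivity).
    rewrite EN, Emu in H1, H2, H3.
    assert (PN := gauss_denom_pos m g h u v).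
    set (mu := gauss_scale m g h u v) in *. set (N := gauss_denom m g h u v) in *.
    assert (Ep : Derive g u = p ^ (2 * m - 1)) by (symmetry; apply odd_root_pow; auto).
    assert (Ew : Derive h v = w ^ (2 * m - 1)) by (symmetry; apply odd_root_pow; auto).
    (* The off-diagonal coefficients are the second coordinate of eta_u and the first of eta_v; the
       third coordinates then confirm that both vectors are tangent. *)
    exists (mu * p ^ (2 * m - 1) * dp * w / N), (mu * w ^ (2 * m - 1) * dw * p / N).
    rewrite du_translation_surface, dv_translation_surface
      by (eexists; eapply smooth_on_is_derive; eauto).
    rewrite !graph_tangent. rewrite Ep, Ew, (even_pow_split m p), (even_pow_split m w) by exact Hm.
    rewrite (even_pow_split m w) in G1 by exact Hm.
    rewrite (even_pow_split m p) in H1 by exact Hm.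
    split; unfold du, dv.
    - repeat (apply pair_equal_spec; split).
      + exact (is_derive_unique _ _ _ G1).
      + exact (is_derive_unique _ _ _ G2).
      + etransitivity; [exact (is_derive_unique _ _ _ G3)|]. field. lra.
    - repeat (apply pair_equal_spec; split).
      + rewrite (Derive_ext _ (fun t => x2 (gauss m h g t u))) by (intros t; apply gauss_swap).
        exact (is_derive_unique _ _ _ H2).
      + rewrite (Derive_ext _ (fun t => x1 (gauss m h g t u))) by (intros t; apply gauss_swap).
        exact (is_derive_unique _ _ _ H1).
      + rewrite (Derive_ext _ (fun t => x3 (gauss m h g t u))) by (intros t; apply gauss_swap).
        etransitivity; [exact (is_derive_unique _ _ _ H3)|]. field. lra. }
  assert (Iff : forall u v,
    let p := slope m g u in let w := slope m h v in
    let dp := Derive (slope m g) u in let dw := Derive (slope m h) v in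
    0 = / 2 * (- (gauss_scale m g h u v * dp * (1 + w ^ (2 * m)) / gauss_denom m g h u v)
               + - (gauss_scale m g h u v * dw * (1 + p ^ (2 * m)) / gauss_denom m g h u v))
    <-> dp / (1 + p ^ (2 * m)) = - (dw / (1 + w ^ (2 * m)))).
  { intros u v p w dp dw.
    assert (PN := gauss_denom_pos m g h u v). assert (Pmu := gauss_scale_pos m g h u v).
    assert (Pp := one_plus_even_pow_pos m p). assert (Pw := one_plus_even_pow_pos m w).
    set (mu := gauss_scale m g h u v) in *. set (N := gauss_denom m g h u v) in *.
    set (P := 1 + p ^ (2 * m)) in *. set (W := 1 + w ^ (2 * m)) in *.
    (* Half the trace is a nonzero factor times the separated expression, so they vanish
       together. *)
    assert (E : / 2 * (- (mu * dp * W / N) + - (mu * dw * P / N)) =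
                - (mu * P * W / (2 * N)) * (dp / P + dw / W)) by (field; lra).
    assert (Pc : 0 < mu * P * W / (2 * N))
      by (apply Rdiv_lt_0_compat; [apply Rmult_lt_0_compat; [nra | lra] | lra]).
    rewrite E. split; intros H.
    - symmetry in H. apply Rmult_integral in H. lra.
    - replace (dp / P + dw / W) with 0 by lra. ring. }
  split.
  - intros (eta & G & H) u v Iu Jv.
    assert (E : forall u v, rect I J u v -> eta u v = gauss m g h u v).
    { intros x y [Ix Jy]. apply birkhoff_gauss_map_unique with (rect I J); auto.
      - split; auto.
      - eexists; eapply smooth_on_is_derive; eauto.
      - eexists; eapply smooth_on_is_derive; eauto. }
    assert (D : rect I J u v) by (split; auto).
    assert (E1 : locally u (fun t => eta t v = gauss m g h t v))
      by (generalize (locally_slice1 _ u v O D); apply filter_imp; auto).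
    assert (E2 : locally v (fun t => eta u t = gauss m g h u t))
      by (generalize (locally_slice2 _ u v O D); apply filter_imp; auto).
    destruct (H u v D) as (a & b & c & d & Ha & Hd & Hn).
    destruct (Main u v Iu Jv) as (b' & c' & Ha' & Hd').
    rewrite du_translation_surface, dv_translation_surface in *
      by (eexists; eapply smooth_on_is_derive; eauto).
    rewrite graph_tangent in *.
    (* Whatever matrix witnesses zero mean curvature, its diagonal entries are read off as
       coordinates of the derivatives of [eta], which agrees with [gauss] near (u, v). *)
    apply Iff. rewrite Hn. f_equal. f_equal.
    + apply (f_equal x1) in Ha, Ha'. change (x1 (du eta u v) = a) in Ha.
      rewrite <- Ha. etransitivity; [|exact Ha']. unfold du, x1 at 1 3. simpl.
      apply Derive_ext_loc. revert E1. apply filter_imp. intros t ->. reflexivity.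
    + apply (f_equal x2) in Hd, Hd'. change (x2 (dv eta u v) = d) in Hd.
      rewrite <- Hd. etransitivity; [|exact Hd']. unfold dv, x2 at 1 3. simpl.
      apply Derive_ext_loc. revert E2. apply filter_imp. intros t ->. reflexivity.
  - intros H. exists (gauss m g h). split.
    + apply gauss_is_birkhoff_gauss_map; auto.
    + intros u v [Iu Jv]. destruct (Main u v Iu Jv) as (b & c & Ha & Hd).
      do 4 eexists. split; [exact Ha|]. split; [exact Hd|]. apply Iff, H; auto.
Qed.

(** * Solving the minimal surface equation *)

(** The origin of F_m: each side of the separated equation becomes an exact derivative. *)
Lemma F_slope_is_derive (m : nat) (I : R -> Prop) (g : R -> R) (u : R) :
  open I -> smooth_on I g -> (forall u, I u -> Derive g u <> 0) -> I u ->
  is_derive (fun t => F m (slope m g t)) u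
    ((2 * INR m - 1) * (Derive (slope m g) u / (1 + slope m g u ^ (2 * m)))).
Proof.
  intros OI Sg Ng Iu. assert (P := one_plus_even_pow_pos m (slope m g u)).
  replace ((2 * INR m - 1) * (Derive (slope m g) u / (1 + slope m g u ^ (2 * m))))
    with (Derive (slope m g) u * ((2 * INR m - 1) / (1 + slope m g u ^ (2 * m))))
    by (field; lra).
  apply (is_derive_comp (F m) (slope m g)); [apply F_is_derive |].
  apply slope_is_derive with I; auto.
Qed.

Lemma F_slope_affine (m : nat) (I : R -> Prop) (g : R -> R) (c : R) :
  nonempty_open_interval I -> smooth_on I g -> (forall u, I u -> Derive g u <> 0) ->
  (forall u, I u -> Derive (slope m g) u / (1 + slope m g u ^ (2 * m)) = c) ->
  exists b, forall u, I u -> F m (slope m g u) = (2 * INR m - 1) * c * u + b.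
Proof.
  intros HI Sg Ng Hc. assert (HI' := HI). destruct HI' as ((u0 & Iu0) & OI & _).
  exists (F m (slope m g u0) - (2 * INR m - 1) * c * u0). intros u Iu.
  enough (F m (slope m g u) - (2 * INR m - 1) * c * u =
          F m (slope m g u0) - (2 * INR m - 1) * c * u0) by lra.
  apply (eq_on_interval I (fun t => F m (slope m g t))
           (fun t => (2 * INR m - 1) * c * t) (fun _ => (2 * INR m - 1) * c)); auto.
  - intros z Iz. rewrite <- (Hc z Iz). apply F_slope_is_derive with I; auto.
  - intros z _. auto_derive; [exact Logic.I | ring].
Qed.

Lemma slope_speed (m : nat) (I : R -> Prop) (g : R -> R) (a b u : R) :
  (1 <= m)%nat -> open I -> smooth_on I g -> (forall u, I u -> Derive g u <> 0) ->
  (forall u, I u -> F m (slope m g u) = a * u + b) -> I u ->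
  Derive (slope m g) u / (1 + slope m g u ^ (2 * m)) = a / (2 * INR m - 1).
Proof.
  intros Hm OI Sg Ng HF Iu. apply le_INR in Hm. simpl in Hm.
  assert (D := F_slope_is_derive m I g u OI Sg Ng Iu).
  assert (E : is_derive (fun t => F m (slope m g t)) u a).
  { apply is_derive_ext_loc with (fun t => a * t + b).
    - generalize (OI u Iu). apply filter_imp. intros t It. symmetry. auto.
    - auto_derive; [exact Logic.I | ring]. }
  apply is_derive_unique in D. apply is_derive_unique in E.
  apply Rmult_eq_reg_l with (2 * INR m - 1); [|lra].
  rewrite <- D, E. field. lra.
Qed.

Lemma slope_constant (m : nat) (I : R -> Prop) (g : R -> R) (k u : R) :
  open I -> (forall u, I u -> Derive g u = k) -> I u -> Derive (slope m g) u = 0.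
Proof.
  intros OI Hk Iu. rewrite <- (Derive_const (odd_root m k) u).
  apply Derive_ext_loc. generalize (OI u Iu). apply filter_imp.
  intros t It. unfold slope. rewrite Hk; auto.
Qed.

(** Injectivity of F_m makes the slope constant, and g' is its (2m-1)-th power. *)
Lemma affine_of_F_slope_constant (m : nat) (I : R -> Prop) (g : R -> R) (b : R) :
  (1 <= m)%nat -> nonempty_open_interval I -> smooth_on I g ->
  (forall u, I u -> Derive g u <> 0) ->
  (forall u, I u -> F m (slope m g u) = b) ->
  exists k d, forall u, I u -> g u = k * u + d.
Proof.
  intros Hm HI Sg Ng HF. assert (HI' := HI). destruct HI' as ((u0 & Iu0) & OI & _).
  exists (Derive g u0), (g u0 - Derive g u0 * u0). intros u Iu.
  enough (g u - Derive g u0 * u = g u0 - Derive g u0 * u0) by lra.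
  apply (eq_on_interval I g (fun t => Derive g u0 * t) (fun _ => Derive g u0)); auto.
  - intros z Iz. replace (Derive g u0) with (Derive g z).
    + apply smooth_on_is_derive with I; auto.
    + rewrite <- (odd_root_pow m (Derive g z)), <- (odd_root_pow m (Derive g u0)) by auto.
      f_equal. apply (F_injective m); [exact Hm |].
      transitivity b; [|symmetry]; apply HF; auto.
  - intros z _. auto_derive; [exact Logic.I | ring].
Qed.

(** * The explicit surfaces and their reparametrization *)

(** The conditions on (I, G, a) and on (J, K, -a) have the same shape; one half carries the
    arguments for both. *)
Definition explicit_half (m : nat) (a : R) (I : R -> Prop) (G : R -> R) : Prop :=
  nonempty_open_interval I /\
  (forall u, I u -> F_range m (a * u) /\ a * u <> 0) /\
  (forall u, I u -> is_derive G u (Finv m (a * u) ^ (2 * m - 1))).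

Lemma explicit_data_halves (m : nat) (a : R) (I J : R -> Prop) (G K : R -> R) :
  explicit_data m a I J G K <-> explicit_half m a I G /\ explicit_half m (- a) J K.
Proof. unfold explicit_data, explicit_half. tauto. Qed.

Lemma nonempty_open_interval_shift (I : R -> Prop) (c : R) :
  nonempty_open_interval I -> nonempty_open_interval (fun u => I (u - c)).
Proof.
  intros ((u0 & Iu0) & OI & CI). split; [|split].
  - exists (u0 + c). replace (u0 + c - c) with u0 by ring. exact Iu0.
  - apply (open_comp (fun u : R => u - c)); [|exact OI]. intros u _.
    apply (ex_derive_continuous (fun u => u - c)). auto_derive. exact Logic.I.
  - intros x y z Ix Iz Hy. apply (CI (x - c) _ (z - c)); auto. lra.
Qed.

(** Shifting the parameter by b / a absorbs the integration constant, since a (u - b / a) + b = a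
    u. *)
Lemma explicit_half_of_F_slope (m : nat) (I : R -> Prop) (g : R -> R) (a b : R) :
  (1 <= m)%nat -> a <> 0 -> nonempty_open_interval I -> smooth_on I g ->
  (forall u, I u -> Derive g u <> 0) ->
  (forall u, I u -> F m (slope m g u) = a * u + b) ->
  explicit_half m a (fun u => I (u - b / a)) (fun u => g (u - b / a)).
Proof.
  intros Hm Ha HI Sg Ng HF.
  assert (E : forall u, I (u - b / a) -> F m (slope m g (u - b / a)) = a * u)
    by (intros u Iu; rewrite HF by exact Iu; field; exact Ha).
  split; [|split].
  - apply nonempty_open_interval_shift, HI.
  - intros u Iu. split; [exists (slope m g (u - b / a)); auto |].
    (* a u = 0 would give F_m(slope) = F_m(0), hence a zero slope, contrary to g' nonzero. *)
    intros H0. rewrite <- (E u Iu), <- (F_0 m) in H0.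
    apply (F_injective m _ _ Hm) in H0. revert H0. apply odd_root_neq_0, Ng, Iu.
  - intros u Iu. rewrite <- (E u Iu), (Finv_F m _ Hm).
    unfold slope. rewrite odd_root_pow by auto.
    rewrite <- (Rmult_1_l (Derive g _)).
    apply (is_derive_comp g (fun t => t - b / a)).
    + apply smooth_on_is_derive with I; auto.
    + auto_derive; [exact Logic.I | ring].
Qed.

(** Converse of the previous construction. Since a (T + u) is nonzero, so is its preimage under F_m;
    hence the odd root undoes the power 2m - 1, and F_m undoes [Finv]. [T] is a horizontal component
    of the translation, [c] a vertical offset. *)
Lemma F_slope_of_explicit_half (m : nat) (I I' : R -> Prop) (g G : R -> R) (a T c : R) :
  (1 <= m)%nat -> open I -> explicit_half m a I' G ->
  (forall u, I u -> I' (T + u) /\ g u = G (T + u) + c) ->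
  forall u, I u -> F m (slope m g u) = a * u + a * T.
Proof.
  intros Hm OI (_ & Rg & DG) H u Iu. destruct (H u Iu) as [Iu' _].
  destruct (Rg _ Iu') as [Ra Na].
  assert (D : Derive g u = Finv m (a * (T + u)) ^ (2 * m - 1)).
  { apply is_derive_unique. apply is_derive_ext_loc with (fun t => G (T + t) + c).
    - generalize (OI u Iu). apply filter_imp. intros t It. symmetry. apply (H t It).
    - rewrite <- (Rplus_0_r (_ ^ _)).
      apply (is_derive_plus (fun t => G (T + t)) (fun _ => c));
        [|apply (is_derive_const (c : R_NormedModule))].
      rewrite <- (Rmult_1_l (_ ^ _)).
      apply (is_derive_comp G (fun t => T + t)); [apply DG, Iu' |].
      auto_derive; [exact Logic.I | ring]. }
  assert (N : Finv m (a * (T + u)) <> 0).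
  { intros H0. apply Na. rewrite <- (F_Finv m _ Ra), H0. apply F_0. }
  unfold slope. rewrite D, pow_odd_root by assumption.
  rewrite F_Finv by exact Ra. ring.
Qed.

Lemma parameter_is_derive (m : nat) (a u : R) :
  (1 <= m)%nat -> F_range m (a * u) ->
  is_derive (fun t => Finv m (a * t)) u
    (a * (1 + Finv m (a * u) ^ (2 * m)) / (2 * INR m - 1)).
Proof.
  intros Hm Rg. unfold Rdiv. rewrite Rmult_assoc.
  apply (is_derive_comp (Finv m) (fun t => a * t)).
  - apply Finv_is_derive; auto.
  - auto_derive; [exact Logic.I | ring].
Qed.

(* The parameter [Finv m (a u)] solves an ODE whose right-hand side is a
   polynomial in the solution, so smoothness bootstraps. *)
Lemma parameter_smooth (m : nat) (a : R) (I : R -> Prop) :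
  (1 <= m)%nat -> open I -> (forall u, I u -> F_range m (a * u)) ->
  smooth_on I (fun u => Finv m (a * u)).
Proof.
  intros Hm OI Rg.
  assert (O := open2_rect I (fun _ => True) OI open_true).
  apply Ck2_on_smooth_on. induction k as [|k IH].
  all: assert (C : forall u v, rect I (fun _ => True) u v ->
    continuity_2d_pt (fun u _ => Finv m (a * u)) u v)
    by (intros u v [Iu _];
        apply (continuity_1d_2d_pt_comp (fun u => Finv m (a * u)) (fun u _ => u));
        [ apply continuity_pt_filterlim;
          apply (ex_derive_continuous (fun u => Finv m (a * u)));
          eexists; apply parameter_is_derive; auto
        | apply continuity_2d_pt_id1 ]).
  - split; auto.
  - apply Ck2_on_S with
      (fun u _ => a / (2 * INR m - 1) * (1 + Finv m (a * u) ^ (2 * m))) (fun _ _ => 0);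
      auto.
    + intros u v [Iu _].
      replace (a / (2 * INR m - 1) * (1 + Finv m (a * u) ^ (2 * m)))
        with (a * (1 + Finv m (a * u) ^ (2 * m)) / (2 * INR m - 1)).
      * apply parameter_is_derive; auto.
      * unfold Rdiv. ring.
    + intros u v _. apply (is_derive_const (Finv m (a * u) : R_NormedModule)).
    + apply (Ck2_on_mult k _ (fun _ _ => a / (2 * INR m - 1))
               (fun u _ => 1 + Finv m (a * u) ^ (2 * m)));
        [exact O | apply Ck2_on_const, O |].
      apply (Ck2_on_plus k _ (fun _ _ => 1) (fun u _ => Finv m (a * u) ^ (2 * m)));
        [exact O | apply Ck2_on_const, O |].
      apply (Ck2_on_pow k (2 * m) _ (fun u _ => Finv m (a * u))); auto.
    + apply Ck2_on_const, O.
Qed.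

(** The inverse parameter change s -> F_m(s) / a is continuous and monotone, so the preimage of [I]
    under it is again an open interval. *)
Lemma parameter_change (m : nat) (a : R) (I : R -> Prop) (G : R -> R) :
  (1 <= m)%nat -> a <> 0 -> explicit_half m a I G ->
  change_of_parameter I (fun s => I (F m s / a)) (fun u => Finv m (a * u)).
Proof.
  intros Hm Ha (((u0 & Iu0) & OI & CI) & Rg & _).
  assert (Hm' := le_INR _ _ Hm). simpl in Hm'.
  assert (Fth : forall u, I u -> F m (Finv m (a * u)) / a = u).
  { intros u Iu. rewrite F_Finv by apply Rg, Iu. field. exact Ha. }
  split; [split; [|split] | split; [|split; [|split]]].
  - exists (Finv m (a * u0)). rewrite Fth by exact Iu0. exact Iu0.
  - apply (open_comp (fun s : R => F m s / a)); [|exact OI]. intros s _.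
    apply (ex_derive_continuous (fun s => F m s / a)).
    apply (ex_derive_ext (fun s => / a * F m s)).
    + intros t. simpl. unfold Rdiv. ring.
    + apply (ex_derive_scal (F m)). eexists. apply F_is_derive.
  - intros x y z Ix Iz [Hxy Hyz].
    assert (M : forall s t, s <= t -> F m s <= F m t).
    { intros s t [L | ->]; [left; apply F_increasing; auto | right; reflexivity]. }
    apply M in Hxy. apply M in Hyz. unfold Rdiv in *.
    (* For a < 0 the map s -> F_m(s) / a reverses order, so the end points change places. *)
    destruct (Rdichotomy _ _ Ha) as [L | L].
    + apply (CI (F m z * / a) _ (F m x * / a)); auto.
      apply Rinv_lt_0_compat in L. split; nra.
    + apply (CI (F m x * / a) _ (F m z * / a)); auto.
      apply Rinv_0_lt_compat in L. split; apply Rmult_le_compat_r; lra.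
  - apply parameter_smooth; auto. intros u Iu. apply Rg, Iu.
  - intros u Iu.
    replace (Derive _ u) with (a * (1 + Finv m (a * u) ^ (2 * m)) / (2 * INR m - 1))
      by (symmetry; apply is_derive_unique, parameter_is_derive; auto; apply Rg, Iu).
    assert (P := one_plus_even_pow_pos m (Finv m (a * u))).
    unfold Rdiv. repeat apply Rmult_integral_contrapositive_currified; auto.
    + lra.
    + apply Rinv_neq_0_compat. lra.
  - intros u w Iu Iw E. rewrite <- (Fth u Iu), <- (Fth w Iw), E. reflexivity.
  - intros s. split.
    + intros Is. exists (F m s / a). split; [exact Is|].
      replace (a * (F m s / a)) with (F m s) by (field; exact Ha). apply Finv_F, Hm.
    + intros (u & Iu & <-). rewrite Fth by exact Iu. exact Iu.
Qed.

(** Substituting s = Finv(a u) gives a du = (2m - 1) ds / (1 + s^(2m)), so the integral of s^(2m-1)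
    du becomes a logarithm. *)
Lemma explicit_half_antiderivative (m : nat) (a : R) (I : R -> Prop) (G : R -> R) :
  (1 <= m)%nat -> a <> 0 -> explicit_half m a I G ->
  exists c, forall u, I u ->
    c + G u = / a * ((2 * INR m - 1) / (2 * INR m) * ln (1 + Finv m (a * u) ^ (2 * m))).
Proof.
  intros Hm Ha (HI & Rg & DG). assert (HI' := HI). destruct HI' as ((u0 & Iu0) & _ & _).
  assert (Hm' := le_INR _ _ Hm). simpl in Hm'.
  set (L := fun u => / a * ((2 * INR m - 1) / (2 * INR m) *
                       ln (1 + Finv m (a * u) ^ (2 * m)))).
  exists (L u0 - G u0). intros u Iu. fold (L u).
  enough (L u - G u = L u0 - G u0) by lra.
  apply (eq_on_interval I L G (fun u => Finv m (a * u) ^ (2 * m - 1))); auto.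
  intros z Iz.
  assert (Dth := parameter_is_derive m a z Hm (proj1 (Rg z Iz))).
  assert (P := one_plus_even_pow_pos m (Finv m (a * z))).
  assert (Dl : is_derive (fun s => ln (1 + s ^ (2 * m))) (Finv m (a * z))
     (2 * INR m * Finv m (a * z) ^ (2 * m - 1) / (1 + Finv m (a * z) ^ (2 * m)))).
  { auto_derive; [exact P |].
    change (m + (m + 0))%nat with (2 * m)%nat. rewrite <- Nat.sub_1_r, mult_INR.
    simpl INR. field. lra. }
  assert (D := is_derive_comp (fun s => ln (1 + s ^ (2 * m)))
    (fun t => Finv m (a * t)) z _ _ Dl Dth).
  apply (is_derive_scal _ _ ((2 * INR m - 1) / (2 * INR m))) in D.
  apply (is_derive_scal _ _ (/ a)) in D.
  replace (Finv m (a * z) ^ (2 * m - 1)) with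
    (/ a * ((2 * INR m - 1) / (2 * INR m) *
      (a * (1 + Finv m (a * z) ^ (2 * m)) / (2 * INR m - 1) *
       (2 * INR m * Finv m (a * z) ^ (2 * m - 1) / (1 + Finv m (a * z) ^ (2 * m)))))).
  - exact D.
  - field. repeat split; lra.
Qed.

(** * The two directions of the classification *)

(** Differentiating the plane equation in u and in v shows that g' and h' are constant, so both
    sides of the separated equation are 0. *)
Lemma in_plane_minimal (m : nat) (I J : R -> Prop) (g h : R -> R) :
  (1 <= m)%nat -> nonempty_open_interval I -> nonempty_open_interval J ->
  smooth_on I g -> smooth_on J h ->
  (forall u, I u -> Derive g u <> 0) -> (forall v, J v -> Derive h v <> 0) ->
  in_plane (rect I J) (translation_surface g h) ->
  minimal m (rect I J) (translation_surface g h).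
Proof.
  intros Hm ((u0 & Iu0) & OI & _) ((v0 & Jv0) & OJ & _) Sg Sh Ng Nh
    ([[n1 n2] n3] & d & Nn & H).
  unfold dot, translation_surface, x1, x2, x3 in H. cbn [fst snd] in H.
  assert (Eg : forall u, I u -> n1 + n3 * Derive g u = 0).
  { intros u Iu. assert (Du := smooth_on_is_derive I g u Sg Iu).
    transitivity (Derive (fun t => n1 * t + n2 * v0 + n3 * (g t + h v0)) u).
    - symmetry. apply is_derive_unique. auto_derive.
      + eexists; exact Du.
      + change (Derive (fun x => g x) u) with (Derive g u). ring.
    - rewrite <- (Derive_const d u). apply Derive_ext_loc.
      generalize (OI u Iu). apply filter_imp. intros t It. apply H. split; auto. }
  assert (Eh : forall v, J v -> n2 + n3 * Derive h v = 0).
  { intros v Jv. assert (Dv := smooth_on_is_derive J h v Sh Jv).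
    transitivity (Derive (fun t => n1 * u0 + n2 * t + n3 * (g u0 + h t)) v).
    - symmetry. apply is_derive_unique. auto_derive.
      + eexists; exact Dv.
      + change (Derive (fun x => h x) v) with (Derive h v). ring.
    - rewrite <- (Derive_const d v). apply Derive_ext_loc.
      generalize (OJ v Jv). apply filter_imp. intros t Jt. apply H. split; auto. }
  (* With n3 = 0 the two differentiated equations would force n1 = n2 = 0 as well. *)
  assert (N3 : n3 <> 0).
  { intros ->. apply Nn. specialize (Eg u0 Iu0). specialize (Eh v0 Jv0).
    replace n1 with 0 by lra. replace n2 with 0 by lra. reflexivity. }
  apply minimal_translation_surface; auto. intros u v Iu Jv.
  rewrite (slope_constant m I g (- n1 / n3)), (slope_constant m J h (- n2 / n3)); auto.
  - unfold Rdiv. ring.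
  - intros w Jw. apply Rmult_eq_reg_l with n3; [|exact N3].
    specialize (Eh w Jw). field_simplify; lra.
  - intros w Iw. apply Rmult_eq_reg_l with n3; [|exact N3].
    specialize (Eg w Iw). field_simplify; lra.
Qed.

(** An inclusion of point sets becomes a relation between parametrizations because the first two
    coordinates of a translation surface are its parameters: (u, v) corresponds to (T1 + u, T2 +
    v). *)
Lemma explicit_minimal (m : nat) (I J I' J' : R -> Prop) (g h G K : R -> R) (a : R) :
  (1 <= m)%nat -> nonempty_open_interval I -> nonempty_open_interval J ->
  smooth_on I g -> smooth_on J h ->
  (forall u, I u -> Derive g u <> 0) -> (forall v, J v -> Derive h v <> 0) ->
  explicit_data m a I' J' G K ->
  equal_up_to_translation
    (surface (rect I J) (translation_surface g h))
    (surface (rect I' J') (translation_surface G K)) ->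
  minimal m (rect I J) (translation_surface g h).
Proof.
  intros Hm ((u0 & Iu0) & OI & _) ((v0 & Jv0) & OJ & _) Sg Sh Ng Nh
    [HG HK]%explicit_data_halves [[[T1 T2] T3] HT].
  assert (Hm' := le_INR _ _ Hm). simpl in Hm'.
  assert (H : forall u v, I u -> J v ->
    I' (T1 + u) /\ J' (T2 + v) /\ T3 + (g u + h v) = G (T1 + u) + K (T2 + v)).
  { intros u v Iu Jv. destruct (proj1 (HT (u, v, g u + h v))) as (x & y & [Ix Jy] & E).
    - exists u, v. repeat split; auto.
    - rewrite plus_R3 in E. unfold translation_surface in E.
      apply pair_equal_spec in E as [E E3]. apply pair_equal_spec in E as [<- <-].
      auto. }
  (* Freezing v at v0 compares g with G up to a constant; freezing u at u0 does the same for h and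
     K. *)
  assert (Eg := F_slope_of_explicit_half m I I' g G a T1 (K (T2 + v0) - h v0 - T3) Hm OI HG).
  assert (Eh := F_slope_of_explicit_half m J J' h K (- a) T2 (G (T1 + u0) - g u0 - T3) Hm OJ HK).
  apply minimal_translation_surface; auto. intros u v Iu Jv.
  rewrite (slope_speed m I g a (a * T1)), (slope_speed m J h (- a) (- a * T2)); auto.
  - field. lra.
  - apply Eh. intros w Jw. destruct (H u0 w Iu0 Jw) as (_ & Jw' & E). split; [exact Jw' | lra].
  - apply Eg. intros w Iw. destruct (H w v0 Iw Jv0) as (Iw' & _ & E). split; [exact Iw' | lra].
Qed.

Lemma surface_shift (I J : R -> Prop) (g h : R -> R) (b c : R) :
  equal_up_to_translation
    (surface (rect I J) (translation_surface g h))
    (surface (rect (fun u => I (u - b)) (fun v => J (v - c)))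
       (translation_surface (fun u => g (u - b)) (fun v => h (v - c)))).
Proof.
  exists ((b, c, 0) : R3). intros [[p1 p2] p3]. rewrite plus_R3. split.
  - intros (u & v & [Iu Jv] & E). apply pair_equal_spec in E as [E ->].
    apply pair_equal_spec in E as [-> ->]. exists (b + u), (c + v).
    unfold rect, translation_surface.
    replace (b + u - b) with u by ring. replace (c + v - c) with v by ring.
    rewrite Rplus_0_l. auto.
  - intros (u & v & [Iu Jv] & E). exists (u - b), (v - c). split; [split; auto|].
    unfold translation_surface in *.
    apply pair_equal_spec in E as [E E3]. apply pair_equal_spec in E as [<- <-].
    rewrite Rplus_0_l in E3. rewrite E3. f_equal. f_equal; ring.
Qed.

Lemma minimal_classification (m : nat) (I J : R -> Prop) (g h : R -> R) :
  (1 <= m)%nat -> nonempty_open_interval I -> nonempty_open_interval J ->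
  smooth_on I g -> smooth_on J h ->
  (forall u, I u -> Derive g u <> 0) -> (forall v, J v -> Derive h v <> 0) ->
  minimal m (rect I J) (translation_surface g h) ->
  in_plane (rect I J) (translation_surface g h) \/
  exists a : R, a <> 0 /\
    exists (I' J' : R -> Prop) (G K : R -> R),
      explicit_data m a I' J' G K /\
      equal_up_to_translation
        (surface (rect I J) (translation_surface g h))
        (surface (rect I' J') (translation_surface G K)).
Proof.
  intros Hm HI HJ Sg Sh Ng Nh Hmin.
  assert (HI' := HI). destruct HI' as ((u0 & Iu0) & OI & _).
  assert (HJ' := HJ). destruct HJ' as ((v0 & Jv0) & OJ & _).
  assert (E := proj1 (minimal_translation_surface m I J g h Hm OI OJ Sg Sh Ng Nh) Hmin).
  assert (Hm' := le_INR _ _ Hm). simpl in Hm'.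
  (* The separation constant, read at a base point: comparing with v0 shows that the u-side is
     constant, and comparing with u0 that the v-side is. *)
  set (c := Derive (slope m g) u0 / (1 + slope m g u0 ^ (2 * m))).
  destruct (F_slope_affine m I g c) as [b Hb]; auto.
  { intros u Iu. rewrite (E u v0 Iu Jv0). symmetry. apply (E u0 v0 Iu0 Jv0). }
  destruct (F_slope_affine m J h (- c)) as [b' Hb']; auto.
  { intros v Jv. unfold c. rewrite (E u0 v Iu0 Jv). ring. }
  destruct (Req_dec c 0) as [C0 | C0].
  - left. rewrite C0 in *.
    destruct (affine_of_F_slope_constant m I g b) as (k & d & Hg); auto.
    { intros u Iu. rewrite Hb by exact Iu. ring. }
    destruct (affine_of_F_slope_constant m J h b') as (k' & d' & Hh); auto.
    { intros v Jv. rewrite Hb' by exact Jv. ring. }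
    exists ((- k, - k', 1) : R3), (d + d'). split.
    + intros H. apply (f_equal x3) in H. revert H. exact R1_neq_R0.
    + intros u v [Iu Jv]. unfold dot, translation_surface, x1, x2, x3. cbn [fst snd].
      rewrite (Hg u Iu), (Hh v Jv). ring.
  - right. set (a := (2 * INR m - 1) * c) in *.
    assert (Ha : a <> 0) by (apply Rmult_integral_contrapositive_currified; lra).
    replace ((2 * INR m - 1) * - c) with (- a) in Hb' by (unfold a; ring).
    exists a. split; [exact Ha|].
    do 4 eexists. split; [|apply (surface_shift I J g h (b / a) (b' / - a))].
    apply explicit_data_halves. split; apply explicit_half_of_F_slope; auto. lra.
Qed.

Theorem theorem4p1 :
  forall (m : nat) (I J : R -> Prop) (g h : R -> R),
    (2 <= m)%nat ->
    nonempty_open_interval I -> nonempty_open_interval J ->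
    smooth_on I g -> smooth_on J h ->
    (forall u, I u -> Derive g u <> 0) ->
    (forall v, J v -> Derive h v <> 0) ->
    (minimal m (rect I J) (translation_surface g h) <->
       in_plane (rect I J) (translation_surface g h) \/
       exists a : R, a <> 0 /\
         exists (I' J' : R -> Prop) (G K : R -> R),
           explicit_data m a I' J' G K /\
           equal_up_to_translation
             (surface (rect I J) (translation_surface g h))
             (surface (rect I' J') (translation_surface G K)))
    /\
    (forall (a : R) (I' J' : R -> Prop) (G K : R -> R),
       a <> 0 -> explicit_data m a I' J' G K ->
       exists (Is Jt : R -> Prop) (T : R3),
         change_of_parameter I' Is (fun u => Finv m (a * u)) /\
         change_of_parameter J' Jt (fun v => Finv m (- a * v)) /\
         forall u v, I' u -> J' v ->
           plus T (translation_surface G K u v) =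
           explicit_st m a (Finv m (a * u)) (Finv m (- a * v))).
Proof.
  intros m I J g h Hm2 HI HJ Sg Sh Ng Nh. assert (Hm : (1 <= m)%nat) by lia.
  split; [split|].
  - apply minimal_classification; auto.
  - intros [H | (a & Ha & I' & J' & G & K & H & T)].
    + apply in_plane_minimal; auto.
    + apply explicit_minimal with I' J' G K a; auto.
  - intros a I' J' G K Ha [HG HK]%explicit_data_halves.
    assert (Ha' : - a <> 0) by lra.
    destruct (explicit_half_antiderivative m a I' G Hm Ha HG) as [c Hc].
    destruct (explicit_half_antiderivative m (- a) J' K Hm Ha' HK) as [d Hd].
    (* The translation is vertical: F_m(s) / a = u and - F_m(t) / a = v hold exactly, and only the
       two constants of integration [c] and [d] remain. The parameter - a of the second half
       produces the minus sign before log(1 + t^(2m)). *)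
    exists (fun s => I' (F m s / a)), (fun t => J' (F m t / - a)), ((0, 0, c + d) : R3).
    split; [|split].
    + apply parameter_change with G; auto.
    + apply parameter_change with K; auto.
    + intros u v Iu Jv. unfold translation_surface, explicit_st.
      rewrite plus_R3, scal_R3.
      rewrite !F_Finv by (apply HG + apply HK; assumption).
      replace (c + d + (G u + K v)) with (c + G u + (d + K v)) by ring.
      rewrite (Hc u Iu), (Hd v Jv). assert (Hm' := le_INR _ _ Hm). simpl in Hm'.
      f_equal; [f_equal|]; field; lra.
Qed.
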